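(* There are $f_\alpha\in\omega^\omega$, $\alpha<\mathfrak{c}$, where $\mathfrak{c}=2^{\aleph_0}$ and $\limsup_n f_\alpha(n)=\infty$ for each $\alpha$, such that $f\mathcal{N}(f_\alpha)\not\subseteq f\mathcal{N}(f_\beta)$ for all $\alpha\neq\beta$.
   Context: For $\sigma\in\omega^{<\omega}$, $[\sigma]=\{x\in\omega^\omega:\sigma\subseteq x\}$ and $|\sigma|$ is the length of $\sigma$. For $h\in\omega^\omega$ with $\limsup_n h(n)=\infty$, a set $F\subseteq\omega^\omega$ belongs to $f\mathcal{N}(h)$ if for every $\varepsilon>0$ there is a sequence $(\sigma_n)_{n\in\omega}$ in $\omega^{<\omega}$ with $\sum_{n\in\omega}\frac{1}{h(|\sigma_n|)}<\varepsilon$ and $F\subseteq\bigcup_{n\in\omega}[\sigma_n]$. Convention: $1/0=\infty$. *)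

(* Defs.v *)
From mathcomp Require Import all_boot all_order all_algebra.
From mathcomp Require Import all_classical all_reals all_analysis.

Set Implicit Arguments.
Unset Strict Implicit.
Unset Printing Implicit Defensive.

Import Order.TTheory GRing.Theory Num.Theory.

Local Open Scope classical_set_scope.
Local Open Scope ring_scope.

Definition cylinder (s : seq nat) : set (nat -> nat) :=
  [set x | forall i, (i < size s)%N -> nth 0%N s i = x i].

Definition limsup_infty (R : realType) (h : nat -> nat) : Prop :=
  limn_esup (fun n => (h n)%:R%:E : \bar R) = +oo%E.

(* The inverse is that of the extended reals, for which 0^-1 = +oo. *)
Definition fN (R : realType) (h : nat -> nat) : set (set (nat -> nat)) :=
  [set F | forall eps : R, 0 < eps ->
     exists s : nat -> seq nat,
       (\sum_(0 <= n <oo) ((h (size (s n)))%:R%:E : \bar R)^-1 < eps%:E)%E /\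
       F `<=` \bigcup_n cylinder (s n)].

(* Main.v *)
Require Import Defs.
From mathcomp Require Import all_boot all_order all_algebra.
From mathcomp Require Import all_classical all_reals all_analysis.
From mathcomp Require Import zify.

Set Implicit Arguments.
Unset Strict Implicit.
Unset Printing Implicit Defensive.

Import Order.TTheory GRing.Theory Num.Theory.

Local Open Scope classical_set_scope.

(** The idea is to forbid lengths.  Since 1/0 is infinite, a scale that vanishes
    off a set [A] of naturals only admits covers by cylinders whose lengths lie
    in [A].  All the scales agree with one function [tower] on their own set
    [A], and [tower] grows so fast that [tower n.+1] dwarfs the product of all
    the values up to [tower n].

    If [A `\` B] is infinite, a compact box separates the scale of [A] from
    that of [B] (lemma [masked_tower_separation]).  The box is
    [[set x | forall i, x i < d i]], where coordinate [i], the one that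
    creates the nodes of length [i.+1], does not branch when
    [i.+1 \in A `\` B] and takes [tower i.+1] values otherwise.
    - For [n.+1] in [A `\` B] the box has as many nodes of length [n.+1] as of
      length [n], hence few compared with [tower n.+1]; so it is small for the
      scale of [A] (lemma [fN_of_short_covers]).
    - In a cover of total cost below 1 for the scale of [B], fewer than
      [tower m] cylinders have a given length [m] in [B], whereas coordinate
      [m.-1] of the box has [tower m] possible values; so one of these values
      is the last entry of no such cylinder (lemma [missed_last_entry]).
      Choosing a missed value at every coordinate gives a point of the box
      outside the cover.

    It remains to have continuum many sets of naturals with pairwise infinite
    differences: the branches of the binary tree, once its nodes are numbered,
    form such a family. *)

(** * A fast scale and its restrictions *)

(** The product of [tower i] for [0 < i <= n].  It is defined before [tower]
    because [tower n.+1] has to be exponential in the product up to [n]. *)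
Fixpoint tower_prod n :=
  if n is m.+1 then tower_prod m * (n * 2 ^ tower_prod m) else 1.

Definition tower n := n * 2 ^ tower_prod n.-1.

Definition masked_tower (A : set nat) n := if n \in A then tower n else 0.

Lemma tower_gt0 n : 0 < n -> 0 < tower n.
Proof. by move=> n0; rewrite muln_gt0 n0 expn_gt0. Qed.

Lemma masked_tower_neq0 (A : set nat) n :
  masked_tower A n <> 0 -> [/\ A n, masked_tower A n = tower n & 0 < n].
Proof.
by rewrite /masked_tower; case: ifPn => [/set_mem An|//]; case: n An.
Qed.

(** * Membership in the ideals *)

Lemma limsup_infty_of_unbounded (R : realType) (h : nat -> nat) :
  (forall k, exists2 n, k <= n & k <= h n) -> limsup_infty R h.
Proof.
move=> hP; rewrite /limsup_infty /limn_esup /limf_esup.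
rewrite (_ : [set _ | _ in _] = [set +oo%E]) ?ereal_inf1//.
apply/seteqP; split => [_ [V [N _ NV] <-]|_ ->]; last first.
  exists setT; first exact: filterT.
  apply/eqyP => r r0; have [n nr hn] := hP (Num.bound r).
  apply: (@le_trans _ _ (h n)%:R%:E); last by apply: ereal_sup_ubound; exists n.
  rewrite lee_fin (le_trans (ltW (archi_boundP (ltW r0))))//.
  by rewrite ler_nat.
apply/eqyP => r r0; have [n nr hn] := hP (maxn N (Num.bound r)).
apply: (@le_trans _ _ (h n)%:R%:E); last first.
  apply: ereal_sup_ubound; exists n => //; apply: NV => /=.
  exact: leq_trans (leq_maxl _ _) nr.
rewrite lee_fin (le_trans (ltW (archi_boundP (ltW r0))))//.
by rewrite ler_nat (leq_trans (leq_maxr _ _) hn).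
Qed.

(** A cover in [fN] is an infinite sequence, so a finite list [ts] has to be
    continued by dummy cylinders, which also cost something.  The exponential
    margin in [2 ^ size ts] lets every entry, genuine or dummy, cost at most
    the [j]-th term of one geometric series; the hypothesis itself supplies the
    expensive lengths that the dummies use. *)
Lemma fN_of_short_covers (R : realType) (h : nat -> nat)
    (F : set (nat -> nat)) :
  (forall K, exists n, exists ts : seq (seq nat),
     [/\ all (fun t => size t == n) ts, K * 2 ^ size ts <= h n &
         forall x, F x -> exists2 t, t \in ts & cylinder t x]) ->
  fN R h F.
Proof.
move=> hF e e0; pose K := Num.bound (4%:R / e)%R.
have [n [ts [/allP tsn Kh Fts]]] := hF K.
have /choice[g gP] : forall j, exists m, K * 2 ^ j <= h m.
  move=> j; have [m [us [_ mh _]]] := hF (K * 2 ^ j); exists m.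
  by apply: leq_trans mh; rewrite leq_pmulr// expn_gt0.
pose s j := if j < size ts then nth [::] ts j else nseq (g j) 0.
(* For j < size ts the common length of ts is already large enough. *)
have sP j : K * 2 ^ j <= h (size (s j)).
  rewrite /s; case: ifPn => [jts|_]; last by rewrite size_nseq.
  rewrite (eqP (tsn _ (mem_nth _ jts))) (leq_trans _ Kh)// leq_mul2l.
  by rewrite leq_exp2l// (ltnW jts) orbT.
exists s; split; last first.
  move=> x /Fts[t tts tx]; exists (index t ts) => //.
  by rewrite /s index_mem tts nth_index.
apply: (@le_lt_trans _ _ (\sum_(0 <= j <oo) ((e / 2) / (2 ^ (j + 1))%:R)%:E)%E).
  apply: lee_nneseries => [j _ _|j _]; first by rewrite inve_ge0 lee_fin.
  have Kgt : (4%:R / e < K%:R)%R by apply: archi_boundP; rewrite divr_ge0// ltW.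
  have lb : (4%:R / e * (2 ^ j)%:R <= (h (size (s j)))%:R)%R.
    apply: (@le_trans _ _ (K * 2 ^ j)%:R%R); last by rewrite ler_nat.
    by rewrite natrM ler_wpM2r// ltW.
  have p0 : (0 < 4%:R / e * (2 ^ j)%:R)%R.
    by rewrite mulr_gt0 ?divr_gt0// ltr0n expn_gt0.
  rewrite inver gt_eqF ?(lt_le_trans p0)// lee_fin.
  apply: (@le_trans _ _ (4%:R / e * (2 ^ j)%:R)^-1)%R.
    by rewrite lef_pV2// posrE// (lt_le_trans p0).
  rewrite !invfM invrK addn1 expnS natrM invfM.
  rewrite (_ : 4%:R = 2%:R * 2%:R)%R -?natrM//.
  rewrite natrM invfM le_eqVlt; apply/orP; left; apply/eqP.
  by rewrite mulrA; congr (_ * _)%R; rewrite mulrC mulrA.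
have /cvg_lim := @cvg_geometric_eseries_half R (e / 2)%R 0.
rewrite /eseries /= => -> //.
by rewrite expr0 divr1 lte_fin ltr_pdivrMr// ltr_pMr// ltr1n.
Qed.

(** Pigeonhole: if each of the [h m] values were the last entry of some sequence
    of length [m], these [h m] distinct indices alone would contribute
    [h m * (h m)^-1 = 1] to the sum. *)
Lemma missed_last_entry (R : realType) (h : nat -> nat) (s : nat -> seq nat) m :
  (\sum_(0 <= n <oo) ((h (size (s n)))%:R%:E : \bar R)^-1 < 1%:E)%E ->
  0 < h m ->
  exists2 j, j < h m & forall n, size (s n) = m -> last 0 (s n) <> j.
Proof.
move=> s1 hm; apply/not_exists2P => noj.
have /choice[g gP] : forall j, exists n,
    j < h m -> size (s n) = m /\ last 0 (s n) = j.
  move=> j; have [jm|nj] := ltnP j (h m); last by exists 0.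
  have [//|/existsNP[n /not_implyP[sn /contrapT lj]]] := noj j.
  by exists n.
pose ns := map g (iota 0 (h m)).
have ns_uniq : uniq ns.
  rewrite map_inj_in_uniq ?iota_uniq// => i j; rewrite !mem_iota /= !add0n.
  by move=> /gP[_ ei] /gP[_ ej] gij; rewrite -ei -ej gij.
move: s1; rewrite ltNge => /negP; apply.
rewrite nneseries_esumT => [|n]; last by rewrite inve_ge0 lee_fin.
apply: esum_ge; exists [set` ns]; first by split; [exact: finite_seq|].
rewrite -fsbig_seq// big_map.
rewrite (eq_big_seq (fun=> ((h m)%:R^-1)%:E)) => [|j]; last first.
  rewrite mem_iota add0n => /gP[-> _].
  by rewrite inver pnatr_eq0 gtn_eqF.
rewrite sumEFin big_const_seq count_predT size_iota iter_addr_0 lee_fin.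
by rewrite -[leRHS]mulr_natr mulVf// pnatr_eq0 -lt0n.
Qed.

(** * Nodes of a box *)

Fixpoint box_prefixes (d : nat -> nat) n : seq (seq nat) :=
  if n is m.+1 then [seq rcons t j | t <- box_prefixes d m, j <- iota 0 (d m)]
  else [:: [::]].

Lemma size_box_prefixes d n :
  size (box_prefixes d n.+1) = size (box_prefixes d n) * d n.
Proof. by rewrite /= size_allpairs size_iota. Qed.

Lemma box_prefixes_length d n : all (fun t => size t == n) (box_prefixes d n).
Proof.
elim: n => [//|n /allP IH].
apply/allP => _ /= /allpairsP[[t j] [/= /IH tn _ ->]].
by rewrite size_rcons eqSS.
Qed.

Lemma mem_box_prefixes d (x : nat -> nat) n :
  (forall i, x i < d i) -> mkseq x n \in box_prefixes d n.
Proof.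
move=> xd; elim: n => [//|n IH]; rewrite mkseqS /=.
by apply: allpairs_f => //; rewrite mem_iota add0n xd.
Qed.

Lemma mkseq_cylinder (x : nat -> nat) n : cylinder (mkseq x n) x.
Proof. by move=> i; rewrite size_mkseq => /(nth_mkseq 0 x). Qed.

Lemma size_box_prefixes_tower d n :
  (forall i, d i <= tower i.+1) -> size (box_prefixes d n) <= tower_prod n.
Proof.
move=> dH; elim: n => [//|n IH]; rewrite size_box_prefixes.
by apply: leq_mul (dH n).
Qed.

(** * Separation *)

(** The box is allowed to branch at lengths in [A `&` B], so that the
    diagonal point can avoid cylinders of every length in [B], and a
    cover of cost below 1 already leads to a contradiction. *)
Lemma masked_tower_separation (R : realType) (A B : set nat) :
  (forall k, exists2 n, k <= n & A n /\ ~ B n) ->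
  ~ fN R (masked_tower A) `<=` fN R (masked_tower B).
Proof.
move=> AB sub; pose D := A `\` B.
pose d i := if i.+1 \in D then 1 else tower i.+1.
have d_le i : d i <= tower i.+1.
  by rewrite /d; case: ifP => // _; exact: tower_gt0.
have d_gt0 i : 0 < d i by rewrite /d; case: ifP => // _; exact: tower_gt0.
have [] := sub [set x | forall i, x i < d i] _ 1%R ltr01.
  apply: fN_of_short_covers => K; have [[|n] Kn [An Bn]] := AB K.+1; first by [].
  exists n.+1, (box_prefixes d n.+1); split; first exact: box_prefixes_length.
    rewrite size_box_prefixes /d (mem_set (conj An Bn : D n.+1)) muln1.
    rewrite /masked_tower (mem_set An) /tower /=.
    by rewrite leq_mul// ?leq_exp2l ?size_box_prefixes_tower// ltnW.
  move=> x xd; exists (mkseq x n.+1); first exact: mem_box_prefixes.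
  exact: mkseq_cylinder.
move=> s [s1 cov].
(* A single cylinder of length outside B would have infinite cost. *)
have sB n : masked_tower B (size (s n)) <> 0.
  move=> Bn0; move: s1; rewrite ltNge => /negP; apply.
  apply: le_trans (nneseries_lim_ge n.+1 _); last first.
    by move=> k _ _; rewrite inve_ge0 lee_fin.
  rewrite big_nat_recr//= Bn0 inve0 addey ?leey//.
  rewrite gt_eqF// (@lt_le_trans _ _ 0%E)// sume_ge0// => k _.
  by rewrite inve_ge0 lee_fin.
have /choice[x xP] : forall i, exists j, j < d i /\
    forall n, size (s n) = i.+1 -> last 0 (s n) <> j.
  move=> i; have [Bi|Bi] := pselect (B i.+1); last first.
    exists 0; split => // n sn; have [] := masked_tower_neq0 (sB n).
    by rewrite sn.
  have Hi : masked_tower B i.+1 = tower i.+1 by rewrite /masked_tower mem_set.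
  have [|j jH jP] := missed_last_entry (m := i.+1) s1; first by rewrite Hi tower_gt0.
  exists j; split => //; rewrite /d memNset => [|[]//]; by rewrite -Hi.
have [|n _ xn] := cov x; first by move=> i; case: (xP i).
have [_ _ sn] := masked_tower_neq0 (sB n).
have [_ /(_ n)] := xP (size (s n)).-1; rewrite prednK// => /(_ erefl); apply.
by rewrite -nth_last; apply: xn; rewrite prednK.
Qed.

(** * A family of sets with infinite differences *)

(** The position of the node [(a 0, ..., a k.-1)] in the heap numbering of the
    binary tree: its binary digits are a leading 1 followed by these bits. *)
Fixpoint branch_code (a : nat -> bool) k :=
  if k is l.+1 then a l + (branch_code a l).*2 else 1.

Lemma branch_code_gt a k : k < branch_code a k.
Proof. elim: k => [//|k] /=; lia. Qed.

(** The code determines the node: halving climbs to the parent, and the parity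
    is the last bit. *)
Lemma branch_code_inj a b k l : branch_code a k = branch_code b l ->
  k = l /\ forall i, i < k -> a i = b i.
Proof.
elim: k l => [|k IH] [|l] //=.
- by have := branch_code_gt b l; lia.
- by have := branch_code_gt a k; lia.
move=> e; have ab : a k = b l by move: e; case: (a k); case: (b l) => //=; lia.
have [|kl eqab] := IH l; first by move: e; rewrite ab; lia.
split; first by rewrite kl.
by move=> i; rewrite ltnS leq_eqVlt => /predU1P[->|/eqab//]; rewrite ab kl.
Qed.

(* The index set of cardinality continuum is 2^omega, i.e. nat -> bool. *)
Theorem theorem34 (R : realType) :
  exists f : (nat -> bool) -> nat -> nat,
    (forall a, limsup_infty R (f a)) /\
    (forall a b, a <> b -> ~ (fN R (f a) `<=` fN R (f b))).
Proof.
exists (fun a => masked_tower (range (branch_code a))); split => [a|a b ab].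
  apply: limsup_infty_of_unbounded => k; exists (branch_code a k).
    exact: ltnW (branch_code_gt _ _).
  rewrite /masked_tower mem_set; last by exists k.
  rewrite /tower (leq_trans (ltnW (branch_code_gt a k)))//.
  by rewrite leq_pmulr// expn_gt0.
(* Beyond a coordinate i where a and b differ the two branches are disjoint. *)
have [i abi] : exists i, a i <> b i.
  by apply/existsNP => eqab; apply: ab; apply/funext.
apply: masked_tower_separation => k; exists (branch_code a (k + i.+1)).
  by rewrite ltnW// (leq_ltn_trans _ (branch_code_gt _ _))// leq_addr.
split; first by exists (k + i.+1).
move=> [l _ eqc]; have [_ /(_ i)] := branch_code_inj (esym eqc).
by rewrite leq_addl => /(_ isT).
Qed.
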